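(* Let $\beta\in B_n$ be a braid whose first and last proper Laurent MFW polynomials $h_m$ and $h_M$ both have the $z$-degree of $P_{\widehat\beta}$, i.e. $\deg h_m=\deg h_M=\deg_zP_{\widehat\beta}$. Then, with $b_{\min}(\beta)=1+M-m$, $$P_{\widehat\beta}=P_{O_{b_{\min}(\beta)}}=\left[\frac{1-v^2}{vz}\right]^{b_{\min}(\beta)-1}.$$
   Context: $B_n$ is the braid group on $n$ strands with standard generators $\sigma_1,\dots,\sigma_{n-1}$; $\widehat\beta$ is the oriented link obtained by the standard closure of $\beta$; $w=w(\beta)$ is the exponent sum (writhe) of $\beta$; $O_k$ is the trivial link with $k$ components. The Homflypt polynomial $P_L(v,z)$ of an oriented link $L$ is determined by $P=1$ on the unknot and $P_{D_+}=vz\,P_{D_0}+v^2P_{D_-}$ for diagrams differing at one crossing (positive, smoothed, negative). For $\beta\in B_n$ one can write uniquely $P_{\widehat\beta}(v,z)=v^{w-n+1}\sum_{j=0}^{n-1}h_j(z)v^{2j}$ with $h_j\in\mathbb Z[z,z^{-1}]$ (a consequence of the Morton-Franks-Williams inequality); the $h_j$ are the Laurent MFW polynomials of $\beta$. $m$ and $M$ are the minimal and maximal $j$ with $h_j\ne0$; $h_m$ is the first proper and $h_M$ the last proper Laurent MFW polynomial. $\deg$ denotes the highest power occurring. *)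

(* Defs.v *)
From HB Require Import structures.
From mathcomp Require Import all_boot all_order all_algebra.
From mathcomp Require Import finmap.
From mathcomp.multinomials Require Import monalg.

Set Implicit Arguments.
Unset Strict Implicit.
Unset Printing Implicit Defensive.

Import Order.TTheory GRing.Theory Num.Theory.

Local Open Scope fset_scope.
Local Open Scope ring_scope.

(* The ring R[t, t^-1] of Laurent polynomials: finitely supported functions
   from the exponents in int to R, with the convolution product.  monalg only
   provides the product for exponents in a monoid without inverses; f@_i is
   the coefficient of t^i and << c *g i >> is c t^i. *)
Definition laurent (R : comNzRingType) : Type := {malg R[int]}.

Section LaurentRing.
Variable R : comNzRingType.
Implicit Types f g h : laurent R.

HB.instance Definition _ := GRing.Zmodule.copy (laurent R) {malg R[int]}.

Definition laurent_mul f g : laurent R :=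
  \sum_(i <- msupp f) \sum_(j <- msupp g) << f@_i * g@_j *g (i + j)%R >>.

Definition laurent_one : laurent R := << 1 *g 0%R >>.

Lemma laurent_mulw (d1 d2 : {fset int}) f g :
  msupp f `<=` d1 -> msupp g `<=` d2 ->
  laurent_mul f g =
    \sum_(i <- d1) \sum_(j <- d2) << f@_i * g@_j *g (i + j)%R >>.
Proof.
move=> le1 le2; rewrite /laurent_mul (big_fset_incl _ le1) /=.
  apply/eq_bigr => i _; apply/big_fset_incl => // j _ /mcoeff_outdom ->.
  by rewrite mulr0 monalgU0.
move=> i _ /mcoeff_outdom fi0.
by rewrite big1 // => j _; rewrite fi0 mul0r monalgU0.
Qed.

Lemma laurent_mulC : commutative laurent_mul.
Proof.
move=> f g; rewrite /laurent_mul exchange_big /=.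
by apply/eq_bigr => i _; apply/eq_bigr => j _; rewrite mulrC addrC.
Qed.

Lemma laurent_mulDl : left_distributive laurent_mul +%R.
Proof.
move=> f g h.
rewrite (laurent_mulw (msuppD_le f g) (fsubset_refl (msupp h))).
rewrite (laurent_mulw (fsubsetUl _ (msupp g)) (fsubset_refl (msupp h))).
rewrite (laurent_mulw (fsubsetUr (msupp f) _) (fsubset_refl (msupp h))).
rewrite -big_split /=; apply/eq_bigr => i _.
rewrite -big_split /=; apply/eq_bigr => j _.
by rewrite mcoeffD mulrDl monalgUD.
Qed.

Lemma laurent_mulDr : right_distributive laurent_mul +%R.
Proof.
by move=> f g h; rewrite !(laurent_mulC f) laurent_mulDl.
Qed.

Lemma laurent_mul0 : left_zero 0 laurent_mul.
Proof. by move=> f; rewrite /laurent_mul msupp0 big_seq_fset0. Qed.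

Lemma laurent_mulr0 : right_zero 0 laurent_mul.
Proof. by move=> f; rewrite laurent_mulC laurent_mul0. Qed.

Lemma laurent_mulUU (a b : R) (i j : int) :
  laurent_mul << a *g i >> << b *g j >> = << a * b *g (i + j)%R >>.
Proof.
by rewrite (laurent_mulw msuppU_le msuppU_le) !big_seq_fset1 !mcoeffUU.
Qed.

Lemma laurent_mulE f g :
  laurent_mul f g =
    \sum_(i <- msupp f) laurent_mul << f@_i *g i >> g.
Proof.
apply/eq_bigr => i _.
rewrite (laurent_mulw msuppU_le (fsubset_refl _)) big_seq_fset1.
by apply/eq_bigr => j _; rewrite mcoeffUU.
Qed.

Lemma laurent_mul_suml (s : seq int) (F : int -> laurent R) g :
  laurent_mul (\sum_(i <- s) F i) g = \sum_(i <- s) laurent_mul (F i) g.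
Proof.
by apply: (big_morph (laurent_mul^~ g)) => [f h|];
  rewrite ?laurent_mulDl ?laurent_mul0.
Qed.

Lemma laurent_mul_sumr (s : seq int) (F : int -> laurent R) g :
  laurent_mul g (\sum_(i <- s) F i) = \sum_(i <- s) laurent_mul g (F i).
Proof.
by rewrite laurent_mulC laurent_mul_suml; apply/eq_bigr => i _;
  rewrite laurent_mulC.
Qed.

Lemma laurent_mul1 : left_id laurent_one laurent_mul.
Proof.
move=> f; rewrite (laurent_mulw msuppU_le (fsubset_refl _)) big_seq_fset1.
rewrite [RHS]monalgE; apply/eq_bigr => j _.
by rewrite mcoeffUU mul1r add0r.
Qed.

Lemma laurent_mulA : associative laurent_mul.
Proof.
move=> f g h; rewrite [RHS](congr1 (laurent_mul^~ h) (laurent_mulE f g)).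
rewrite laurent_mulE laurent_mul_suml; apply/eq_bigr => i _.
rewrite (laurent_mulE g) laurent_mul_sumr [in RHS](monalgE g).
rewrite laurent_mul_sumr laurent_mul_suml; apply/eq_bigr => j _.
rewrite laurent_mulUU (monalgE h) (laurent_mul_sumr _ _ << g@_j *g j >>).
rewrite !laurent_mul_sumr; apply/eq_bigr => k _.
by rewrite !laurent_mulUU mulrA addrA.
Qed.

Lemma laurent_one_neq0 : laurent_one != 0.
Proof. by rewrite monalgU_eq0 oner_eq0. Qed.

HB.instance Definition _ := GRing.Zmodule_isComNzRing.Build (laurent R)
  laurent_mulA laurent_mulC laurent_mul1 laurent_mulDl laurent_one_neq0.

End LaurentRing.

(* Z[v, v^-1, z, z^-1], as Laurent polynomials in v over Z[z, z^-1]. *)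
Definition laurent2 : Type := laurent (laurent int).
HB.instance Definition _ := GRing.ComNzRing.copy laurent2 (laurent (laurent int)).

Definition vpow (i : int) : laurent2 := << (1 : laurent int) *g i >>.
Definition zpow (i : int) : laurent2 :=
  << (<< (1 : int) *g i >> : laurent int) *g 0%R >>.

Lemma vpowD i j : vpow (i + j) = vpow i * vpow j.
Proof. by rewrite [RHS]laurent_mulUU mulr1. Qed.

Lemma zpowD i j : zpow (i + j) = zpow i * zpow j.
Proof.
by rewrite [RHS]laurent_mulUU [X in << X *g _ >>]laurent_mulUU mulr1 addr0.
Qed.

Definition is_deg (h : laurent int) (d : int) : Prop :=
  h@_d != 0 /\ forall e : int, h@_e != 0 -> e <= d.

Definition is_zdeg (p : laurent2) (d : int) : Prop :=
  (exists i : int, (p@_i : laurent int)@_d != 0) /\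
  forall i e : int, (p@_i : laurent int)@_e != 0 -> e <= d.

(* Oriented link diagrams, cut by horizontal lines into slices and read from
   top to bottom; each slice is one elementary piece with k vertical strands to
   its left.  A horizontal cut is recorded by the orientations of the strands,
   true meaning downwards.  All crossings are between two downward strands,
   which is always achieved by rotating them.  This is the presentation of the
   category of oriented tangles by generators and relations (Turaev; Kassel,
   Quantum Groups, Theorem XII.2.2). *)
Inductive piece : Type :=
  | Cross of bool   (* true: positive crossing, false: negative crossing *)
  | LocMax of bool  (* creates two strands, the left one oriented as given *)
  | LocMin of bool. (* joins two strands, the left one oriented as given *)

Definition slice : Type := (nat * piece)%type.
Definition diagram : Type := seq slice.

Definition piece_in (p : piece) : seq bool :=
  match p with
  | Cross _ => [:: true; true]
  | LocMax _ => [::]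
  | LocMin d => [:: d; ~~ d]
  end.

Definition piece_out (p : piece) : seq bool :=
  match p with
  | Cross _ => [:: true; true]
  | LocMax d => [:: d; ~~ d]
  | LocMin _ => [::]
  end.

Definition slice_run (x : slice) (s : seq bool) : option (seq bool) :=
  let: (k, p) := x in
  if (k <= size s)%N && prefix (piece_in p) (drop k s)
  then Some (take k s ++ piece_out p ++ drop (k + size (piece_in p)) s)
  else None.

Fixpoint diagram_run (D : diagram) (s : seq bool) : option (seq bool) :=
  if D is x :: D' then obind (diagram_run D') (slice_run x s) else Some s.

Definition link_diagram (D : diagram) : Prop :=
  diagram_run D [::] = Some [::].

(* A crossing between a downward and an upward strand: from (down, up) to
   (up, down) and from (up, down) to (down, up) respectively. *)
Definition side_du (e : bool) : diagram :=
  [:: (0, LocMax false); (1, Cross e); (2, LocMin true)]%N.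
Definition side_ud (e : bool) : diagram :=
  [:: (2, LocMax true); (1, Cross e); (0, LocMin false)]%N.

(* A crossing between two upward strands, obtained from a downward one by a
   half turn in either direction. *)
Definition turn_left (e : bool) : diagram :=
  [:: (0, LocMax false); (1, LocMax false); (2, Cross e);
      (3, LocMin true); (2, LocMin true)]%N.
Definition turn_right (e : bool) : diagram :=
  [:: (2, LocMax true); (3, LocMax true); (2, Cross e);
      (1, LocMin false); (0, LocMin false)]%N.

Inductive local_move : diagram -> diagram -> Prop :=
  (* planar isotopy *)
  | Move_far p q g :
      local_move [:: (0, p); (size (piece_out p) + g, q)]%N
                 [:: (size (piece_in p) + g, q); (0, p)]%N
  | Move_zigzag_left b :
      local_move [:: (1, LocMax (~~ b)); (0, LocMin b)]%N [::]
  | Move_zigzag_right b :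
      local_move [:: (0, LocMax b); (1, LocMin (~~ b))]%N [::]
  | Move_turn e : local_move (turn_left e) (turn_right e)
  (* Reidemeister moves *)
  | Move_R1_right e :
      local_move [:: (1, LocMax true); (0, Cross e); (1, LocMin true)]%N [::]
  | Move_R1_left e :
      local_move [:: (0, LocMax false); (1, Cross e); (0, LocMin false)]%N [::]
  | Move_R2 e : local_move [:: (0, Cross e); (0, Cross (~~ e))]%N [::]
  | Move_R2_du e : local_move (side_du e ++ side_ud (~~ e)) [::]
  | Move_R2_ud e : local_move (side_ud e ++ side_du (~~ e)) [::]
  | Move_R3 e :
      local_move [:: (0, Cross e); (1, Cross e); (0, Cross e)]%N
                 [:: (1, Cross e); (0, Cross e); (1, Cross e)]%N.

Definition shift (k : nat) (D : diagram) : diagram :=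
  [seq ((k + x.1)%N, x.2) | x <- D].

Inductive move : diagram -> diagram -> Prop :=
  | Move (A B L L' : diagram) (k : nat) :
      local_move L L' -> move (A ++ shift k L ++ B) (A ++ shift k L' ++ B).

Definition circle : diagram := [:: (0, LocMax true); (0, LocMin true)]%N.

Definition trivial_link (k : nat) : diagram := flatten (nseq k circle).

(* P is the Homflypt polynomial.  Between two downward strands the oriented
   smoothing of a crossing consists of two vertical strands.  Values of P on
   words that are not link diagrams are unconstrained and irrelevant. *)
Record homflypt (P : diagram -> laurent2) : Prop := Homflypt {
  homflypt_isotopy : forall D D' : diagram,
    link_diagram D -> link_diagram D' -> move D D' -> P D = P D';
  homflypt_unknot : P circle = 1;
  homflypt_skein : forall (A B : diagram) (k : nat),
    link_diagram (A ++ (k, Cross true) :: B) ->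
    P (A ++ (k, Cross true) :: B) =
      vpow 1 * zpow 1 * P (A ++ B) + vpow 2 * P (A ++ (k, Cross false) :: B)
}.

(* Elements of the braid group on n strands, given by words in the generators:
   (i, true) is the generator crossing strands i and i + 1 (counted from 0)
   positively, (i, false) is its inverse. *)
Definition braid (n : nat) : Type := seq ('I_n.-1 * bool).

Definition writhe (n : nat) (beta : braid n) : int :=
  \sum_(x <- beta) (if x.2 then 1 else -1).

(* The n braid strands run down on the left and return on the right through
   nested arcs. *)
Definition braid_closure (n : nat) (beta : braid n) : diagram :=
  [seq (i, LocMax true) | i <- iota 0 n] ++
  [seq (nat_of_ord x.1, Cross x.2) | x <- (beta : seq ('I_n.-1 * bool))] ++
  rev [seq (i, LocMin true) | i <- iota 0 n].

(* The Laurent polynomials h_j of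
   P = v ^ (w - n + 1) * \sum_(j < n) h_j(z) v ^ (2 j); by the
   Morton-Franks-Williams inequality P has no other coefficients. *)
Definition mfw (P : diagram -> laurent2) (n : nat) (beta : braid n) (j : 'I_n) :
    laurent int :=
  (P (braid_closure beta))@_(writhe beta - n%:Z + 1 + j.*2%:Z)%R.

Definition first_proper (n : nat) (h : 'I_n -> laurent int) (m : 'I_n) : Prop :=
  h m != 0 /\ forall j, h j != 0 -> (m <= j)%N.

Definition last_proper (n : nat) (h : 'I_n -> laurent int) (M : 'I_n) : Prop :=
  h M != 0 /\ forall j, h j != 0 -> (j <= M)%N.

(* No truncation occurs, since m <= M for the first and last proper indices. *)
Definition bmin (n : nat) (m M : 'I_n) : nat := (1 + M - m)%N.

(* Main.v *)
Require Import Defs.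
From mathcomp Require Import all_boot all_order all_algebra.
From mathcomp Require Import finmap zify ring.
From mathcomp.multinomials Require Import monalg.
Set Implicit Arguments.
Unset Strict Implicit.
Unset Printing Implicit Defensive.

Import Order.TTheory GRing.Theory Num.Theory.
Local Open Scope ring_scope.

(** Setting z = 1/v - v turns the skein relation into one that the constant 1
    satisfies, so P of every closed braid becomes 1 under this substitution.
    Write P as the sum of the h_j(z) v^(a + 2j), with a = w - n + 1, and let d
    be the common z-degree of P, h_m and h_M.  After the substitution the term
    of highest v-degree comes only from the leading term of h_M, in degree
    a + 2M + d, and the term of lowest v-degree only from that of h_m, in
    degree a + 2m - d.  Both must be 0, so d = m - M = 1 - bmin, and the
    v-degrees of P run from d to -d.

    On the other hand P is a polynomial in v, 1/v, z and the value
    delta = (1/v - v)/z of a disjoint circle.  The coefficient of z^-k in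
    such an expression is divisible by (1 - v^2)^k.  A nonzero multiple of
    (1 - v^2)^k spans at least 2k in v, while the span available is
    2(M - m) = -2d.  Hence the coefficients of z^-k with k > -d vanish, and
    the coefficient of z^d, the only one left, is a monomial times
    (1/v - v)^(-d) with v-degrees from d to -d; so P = c delta^(-d), and the
    substitution gives c = 1.

    Three facts about closed braids are needed: the substitution value
    ([closed_braid_specializes]), the divisibility ([closed_braid_tdivisible])
    and the Morton-Franks-Williams inequality ([closed_braid_mfw]).  All three
    are compatible with the skein relation, with stabilization and with adding
    a circle, so they follow from one induction principle,
    [closed_braid_ind], which is the computation of the Ocneanu trace: modulo
    shorter words signs of crossings do not matter, words become words in the
    symmetric group, and there the highest generator can be made to occur at
    most once ([word_reduce]).  The Laurent polynomial part of the argument is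
    [homflypt_rigidity]. *)

(** * The value of a disjoint circle *)

(** The factor by which a disjoint circle multiplies P. *)
Definition delta : laurent2 := (1 - vpow 2) * (vpow (-1) * zpow (-1)).

Lemma vpowVK k : vpow (- k) * vpow k = 1.
Proof. by rewrite -vpowD addNr. Qed.

Lemma zpowVK k : zpow (- k) * zpow k = 1.
Proof. by rewrite -zpowD addNr. Qed.

Lemma circle_factor (R : comNzRingType) (a b c x : R) :
  a * (b * c) * x = b * c * (a * x).
Proof. by ring. Qed.

Lemma deltaE (p : laurent2) :
  delta * p = vpow (-1) * zpow (-1) * ((1 - vpow 2) * p).
Proof. exact: circle_factor. Qed.

Lemma mul_inv2 (R : comNzRingType) (v v' z z' p q : R) :
  v' * v = 1 -> z' * z = 1 -> v * z * p = q -> p = v' * z' * q.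
Proof. by move=> vV zV <-; rewrite mulrA mulrACA vV zV !mul1r. Qed.

Lemma delta_intro (p q : laurent2) :
  vpow 1 * zpow 1 * p = (1 - vpow 2) * q -> p = delta * q.
Proof.
move=> eq_p; rewrite deltaE.
exact: (@mul_inv2 laurent2 _ _ _ _ p _ (vpowVK 1) (zpowVK 1) eq_p).
Qed.

(** * Tangles that P cannot distinguish *)

Arguments slice_run : simpl never.

Lemma diagram_run_cat D E s :
  diagram_run (D ++ E) s = obind (diagram_run E) (diagram_run D s).
Proof.
elim: D s => [|x D IHD] s //=.
by case: (slice_run x s) => [t|] //=.
Qed.

Lemma slice_run_at a (p : piece) b :
  slice_run (size a, p) (a ++ piece_in p ++ b) = Some (a ++ piece_out p ++ b).
Proof.
rewrite /slice_run size_cat leq_addr drop_size_cat // prefix_prefix /=.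
by rewrite take_size_cat // addnC -drop_drop !drop_size_cat.
Qed.

Lemma slice_runP k (p : piece) s t : slice_run (k, p) s = Some t ->
  exists a b, [/\ size a = k, s = a ++ piece_in p ++ b
                & t = a ++ piece_out p ++ b].
Proof.
rewrite /slice_run; case: ifP => // /andP[le_k /prefixP[b def_b]] [<-].
exists (take k s), b; rewrite size_takel // -def_b cat_take_drop; split=> //.
by rewrite addnC -drop_drop def_b drop_size_cat.
Qed.

(** A tangle still runs with extra vertical strands on both sides. *)
Lemma diagram_run_whisker a b D s t : diagram_run D s = Some t ->
  diagram_run (shift (size a) D) (a ++ s ++ b) = Some (a ++ t ++ b).
Proof.
elim: D s => [|[k p] D IHD] s /= => [[->] //|].
case run_s: (slice_run (k, p) s) => [u|] //= run_u.
have [a' [b' [<- def_s def_u]]] := slice_runP run_s.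
have := slice_run_at (a ++ a') p (b' ++ b).
rewrite -!catA in def_s *; rewrite size_cat def_s -!catA => ->.
by rewrite /= -(IHD _ run_u) def_u -!catA.
Qed.

Section Homflypt.
Variable P : diagram -> laurent2.
Hypothesis hP : homflypt P.

(** P is meaningful only for closed diagrams, so tangles from the cut [s] to the
    cut [t] are compared inside all of their closures. *)
Definition tangle_eq s t D E : Prop :=
  [/\ diagram_run D s = Some t, diagram_run E s = Some t &
      forall A B, diagram_run A [::] = Some s -> diagram_run B t = Some [::] ->
        P (A ++ D ++ B) = P (A ++ E ++ B)].

Lemma tangle_eq_refl s t D : diagram_run D s = Some t -> tangle_eq s t D D.
Proof. by []. Qed.

Lemma tangle_eq_sym s t D E : tangle_eq s t D E -> tangle_eq s t E D.
Proof. by case=> runD runE eqP; split=> // A B runA runB; rewrite eqP. Qed.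

Lemma tangle_eq_trans s t D E F :
  tangle_eq s t D E -> tangle_eq s t E F -> tangle_eq s t D F.
Proof.
case=> runD _ eqDE [_ runF eqEF]; split=> // A B runA runB.
by rewrite eqDE // eqEF.
Qed.

Lemma tangle_eq_cat s t u D D' E E' :
    tangle_eq s t D D' -> tangle_eq t u E E' ->
  tangle_eq s u (D ++ E) (D' ++ E').
Proof.
case=> runD runD' eqD [runE runE' eqE].
split=> [||A B runA runB]; rewrite ?diagram_run_cat ?runD ?runD' //.
rewrite -!catA eqD //; last by rewrite diagram_run_cat runE.
by rewrite !(catA A) eqE // diagram_run_cat runA.
Qed.

Lemma tangle_eq_closed D E : tangle_eq [::] [::] D E -> P D = P E.
Proof. by case=> _ _ /(_ [::] [::] erefl erefl); rewrite !cats0. Qed.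

Lemma tangle_eq_local a b s t L L' : local_move L L' ->
    diagram_run L s = Some t -> diagram_run L' s = Some t ->
  tangle_eq (a ++ s ++ b) (a ++ t ++ b)
    (shift (size a) L) (shift (size a) L').
Proof.
move=> mv /(diagram_run_whisker a b) runL /(diagram_run_whisker a b) runL'.
split=> // A B runA runB; apply: (homflypt_isotopy hP); last by constructor.
  rewrite /link_diagram !diagram_run_cat runA.
  by rewrite [obind _ _]diagram_run_cat runL.
rewrite /link_diagram !diagram_run_cat runA.
by rewrite [obind _ _]diagram_run_cat runL'.
Qed.

(** Pieces with disjoint supports can be performed in either order; [b] are the
    strands between them. *)
Lemma tangle_eq_far a b c (p q : piece) :
  tangle_eq (a ++ piece_in p ++ b ++ piece_in q ++ c)
            (a ++ piece_out p ++ b ++ piece_out q ++ c)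
    [:: (size a, p); (size a + size (piece_out p) + size b, q)]%N
    [:: (size a + size (piece_in p) + size b, q); (size a, p)]%N.
Proof.
have := @tangle_eq_local a c (piece_in p ++ b ++ piece_in q)
  (piece_out p ++ b ++ piece_out q) _ _ (Move_far p q (size b)).
rewrite -!catA /= !addn0 !addnA; apply.
  have /= -> := slice_run_at [::] p (b ++ piece_in q).
  have := slice_run_at (piece_out p ++ b) q [::].
  by rewrite size_cat /= -!catA !cats0 => ->.
have := slice_run_at (piece_in p ++ b) q [::].
rewrite size_cat /= -!catA !cats0 => -> /=.
by have /= -> := slice_run_at [::] p (b ++ piece_out q).
Qed.

(** * Closed braids *)

Definition braid_tangle (w : seq (nat * bool)) : diagram :=
  [seq (x.1, Cross x.2) | x <- w].

Definition top_arcs n : diagram := [seq (i, LocMax true) | i <- iota 0 n].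

Definition bottom_arcs n : diagram :=
  rev [seq (i, LocMin true) | i <- iota 0 n].

Definition level i j : seq bool := nseq i true ++ nseq j false.

Definition closure_poly n w :=
  P (top_arcs n ++ braid_tangle w ++ bottom_arcs n).

Definition braid_word n (w : seq (nat * bool)) := all (fun x => x.1.+1 < n)%N w.

Lemma braid_tangle_cat u v :
  braid_tangle (u ++ v) = braid_tangle u ++ braid_tangle v.
Proof. exact: map_cat. Qed.

Lemma top_arcsS n : top_arcs n.+1 = rcons (top_arcs n) (n, LocMax true).
Proof. by rewrite /top_arcs -addn1 iotaD map_cat cats1. Qed.

Lemma bottom_arcsS n : bottom_arcs n.+1 = (n, LocMin true) :: bottom_arcs n.
Proof. by rewrite /bottom_arcs -addn1 iotaD map_cat rev_cat. Qed.

Lemma level_split i a j :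
  level (i + a) j = nseq i true ++ nseq a true ++ nseq j false.
Proof. by rewrite /level nseqD -catA. Qed.

Lemma levelSS n :
  level n.+1 n.+1 = nseq n true ++ [:: true; false] ++ nseq n false.
Proof. by rewrite -{1}(addn1 n) level_split. Qed.

Lemma run_top_arcs n : diagram_run (top_arcs n) [::] = Some (level n n).
Proof.
elim: n => // n IHn; rewrite top_arcsS -cats1 diagram_run_cat IHn levelSS /=.
have := slice_run_at (nseq n true) (LocMax true) (nseq n false).
by rewrite size_nseq => ->.
Qed.

Lemma run_bottom_arcs n : diagram_run (bottom_arcs n) (level n n) = Some [::].
Proof.
elim: n => // n IHn; rewrite bottom_arcsS levelSS.
have := slice_run_at (nseq n true) (LocMin true) (nseq n false).
by rewrite size_nseq /= => ->.
Qed.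

Lemma levelE n m i k : (i + k <= n)%N ->
  level n m = nseq i true ++ nseq k true ++ level (n - (i + k)) m.
Proof. by move=> le_n; rewrite /level !catA -!nseqD subnKC. Qed.

Lemma run_braid n d w : braid_word n w ->
  diagram_run (braid_tangle w) (nseq n true ++ d) = Some (nseq n true ++ d).
Proof.
elim: w => //= -[i e] w IHw /andP[/= lt_i /IHw runw].
have def_n : nseq n true ++ d
    = nseq i true ++ [:: true; true] ++ (nseq (n - i.+2) true ++ d).
  rewrite !catA; congr (_ ++ d).
  by rewrite -[RHS]/((_ ++ nseq 2 _) ++ _) -!nseqD; congr nseq; lia.
have := slice_run_at (nseq i true) (Cross e) (nseq (n - i.+2) true ++ d).
by rewrite size_nseq def_n /= => ->; rewrite /= -def_n.
Qed.

(** Moves between braid words can be applied inside a closed braid. *)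
Lemma closure_local n i k u v w w' :
    (i + k <= n)%N -> braid_word n u -> braid_word n v ->
    local_move (braid_tangle w) (braid_tangle w') ->
    braid_word k w -> braid_word k w' ->
  closure_poly n (u ++ [seq ((i + x.1)%N, x.2) | x <- w] ++ v) =
  closure_poly n (u ++ [seq ((i + x.1)%N, x.2) | x <- w'] ++ v).
Proof.
move=> le_n wfu wfv mv /run_braid-/(_ [::]) runw /run_braid-/(_ [::]) runw'.
have := tangle_eq_local (nseq i true) (level (n - (i + k)) n) mv runw runw'.
rewrite !cats0 size_nseq -levelE // => -[_ _ eqP].
pose sh := [seq ((i + x.1)%N, x.2) | x : nat * bool <- _].
have shE x : shift i (braid_tangle x) = braid_tangle (sh x).
  by rewrite /shift /braid_tangle -!map_comp.
rewrite /closure_poly !braid_tangle_cat -!shE -!catA.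
rewrite !(catA (top_arcs n)) eqP //.
  by rewrite diagram_run_cat run_top_arcs /= run_braid.
by rewrite diagram_run_cat run_braid //= run_bottom_arcs.
Qed.

Lemma closure_skein n u v i : braid_word n (u ++ (i, true) :: v) ->
  closure_poly n (u ++ (i, true) :: v) =
    vpow 1 * zpow 1 * closure_poly n (u ++ v) +
    vpow 2 * closure_poly n (u ++ (i, false) :: v).
Proof.
move=> wf; rewrite /closure_poly !braid_tangle_cat /= -!catA.
rewrite !(catA (top_arcs n)) /=.
apply: homflypt_skein => //.
have -> : (top_arcs n ++ braid_tangle u) ++
            (i, Cross true) :: braid_tangle v ++ bottom_arcs n =
          top_arcs n ++ braid_tangle (u ++ (i, true) :: v) ++ bottom_arcs n.
  by rewrite braid_tangle_cat -!catA.
rewrite /link_diagram diagram_run_cat run_top_arcs /= diagram_run_cat.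
by rewrite run_braid //= run_bottom_arcs.
Qed.

Lemma closure_cancel n u v i e : braid_word n (u ++ v) -> (i.+1 < n)%N ->
  closure_poly n (u ++ [:: (i, e); (i, ~~ e)] ++ v) = closure_poly n (u ++ v).
Proof.
rewrite /braid_word all_cat => /andP[wfu wfv] lt_i.
have := @closure_local n i 2 u v [:: (0, e); (0, ~~ e)]%N [::].
by rewrite /= !addn0 addn2; apply=> //; apply: Move_R2.
Qed.

Lemma closure_braid n u v i e : braid_word n (u ++ v) -> (i.+2 < n)%N ->
  closure_poly n (u ++ [:: (i, e); (i.+1, e); (i, e)] ++ v) =
  closure_poly n (u ++ [:: (i.+1, e); (i, e); (i.+1, e)] ++ v).
Proof.
rewrite /braid_word all_cat => /andP[wfu wfv] lt_i.
have := @closure_local n i 3 u v [:: (0, e); (1, e); (0, e)]%N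
                            [:: (1, e); (0, e); (1, e)]%N.
by rewrite /= !addn0 addn1 addn3; apply=> //; apply: Move_R3.
Qed.

Lemma closure_commute n u v i j a b :
    braid_word n (u ++ v) -> (i.+1 < j)%N -> (j.+1 < n)%N ->
  closure_poly n (u ++ [:: (i, a); (j, b)] ++ v) =
  closure_poly n (u ++ [:: (j, b); (i, a)] ++ v).
Proof.
rewrite /braid_word all_cat => /andP[wfu wfv] lt_ij lt_j.
have := @closure_local n i (j - i).+2 u v [:: (0, a); (2 + (j - i.+2), b)]%N
                            [:: (2 + (j - i.+2), b); (0, a)]%N.
have -> : (2 + (j - i.+2) = j - i)%N by lia.
have def_j : (i + (j - i) = j)%N by lia.
rewrite /= !addn0 def_j; apply=> //; try lia.
have -> : (j - i = size (piece_out (Cross a)) + (j - i.+2))%N.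
  by rewrite /=; lia.
exact: Move_far.
Qed.

Lemma tangle_eq_cross_far n i e q c : (i.+1 < n)%N ->
  tangle_eq (nseq n true ++ piece_in q ++ c) (nseq n true ++ piece_out q ++ c)
    [:: (i, Cross e); (n, q)] [:: (n, q); (i, Cross e)].
Proof.
move=> lt_i.
have -> : nseq n true = nseq i true ++ [:: true; true] ++ nseq (n - i.+2) true.
  by rewrite -[RHS]/(nseq i _ ++ nseq 2 _ ++ _) -!nseqD; congr nseq; lia.
have := tangle_eq_far (nseq i true) (nseq (n - i.+2) true) c (Cross e) q.
rewrite !size_nseq -!catA /=.
by have -> : (i + 2 + (n - i.+2) = n)%N by lia.
Qed.

(** The innermost arc of a closed braid is attached to the right of all the
    strands of [w], so it can be created or removed before or after [w]. *)
Lemma tangle_eq_slide n q c w : braid_word n w ->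
  tangle_eq (nseq n true ++ piece_in q ++ c) (nseq n true ++ piece_out q ++ c)
    (rcons (braid_tangle w) (n, q)) ((n, q) :: braid_tangle w).
Proof.
have run_q : diagram_run [:: (n, q)] (nseq n true ++ piece_in q ++ c) =
             Some (nseq n true ++ piece_out q ++ c).
  by have /= := slice_run_at (nseq n true) q c; rewrite size_nseq => ->.
elim: w => [_|[i e] w IHw /= /andP[/= lt_i wfw]]; first exact: tangle_eq_refl.
have run_i d : diagram_run [:: (i, Cross e)] (nseq n true ++ d) =
               Some (nseq n true ++ d).
  by have := @run_braid n d [:: (i, e)]; rewrite /= lt_i; apply.
apply: tangle_eq_trans
  (tangle_eq_cat (tangle_eq_refl (run_i _)) (IHw wfw)) _.
exact: tangle_eq_cat (tangle_eq_cross_far e q c lt_i)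
         (tangle_eq_refl (run_braid _ wfw)).
Qed.

(** Markov stabilization in the middle of a word.  The innermost arcs slide
    past [u] and [v] until they meet the crossing [(n, e)], and then they form
    a kink that the first Reidemeister move removes.  Conjugation is avoided
    by allowing words on both sides of the crossing. *)
Lemma closure_stabilize n u v e : braid_word n.+1 u -> braid_word n.+1 v ->
  closure_poly n.+2 (u ++ (n, e) :: v) = closure_poly n.+1 (u ++ v).
Proof.
move=> wfu wfv.
have eq_u := tangle_eq_slide (LocMax true) (nseq n.+1 false) wfu.
have eq_v := tangle_eq_slide (LocMin true) (nseq n.+1 false) wfv.
have run_kink : diagram_run
    [:: (1, LocMax true); (0, Cross e); (1, LocMin true)]%N [:: true] =
    Some [:: true] by [].
have eq_kink := tangle_eq_local (nseq n true) (nseq n.+1 false)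
                  (Move_R1_right e) run_kink erefl.
rewrite size_nseq /= addn0 addn1 -[_ ++ _]levelSS in eq_kink.
have run_t : tangle_eq [::] (level n.+1 n.+1) (top_arcs n.+1) (top_arcs n.+1).
  exact: tangle_eq_refl (run_top_arcs _).
have run_b : tangle_eq (level n.+1 n.+1) [::]
               (bottom_arcs n.+1) (bottom_arcs n.+1).
  exact: tangle_eq_refl (run_bottom_arcs _).
have run_w w : braid_word n.+1 w ->
    tangle_eq (level n.+1 n.+1) (level n.+1 n.+1)
      (braid_tangle w) (braid_tangle w).
  by move=> wf; apply/tangle_eq_refl/run_braid.
have run_c : tangle_eq (level n.+2 n.+2) (level n.+2 n.+2)
    [:: (n, Cross e)] [:: (n, Cross e)].
  have := @run_braid n.+2 (nseq n.+2 false) [:: (n, e)].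
  by rewrite /= leqnn => run_n; apply/tangle_eq_refl/run_n.
rewrite -!levelSS in eq_u eq_v.
have slid := tangle_eq_cat (tangle_eq_sym eq_u) (tangle_eq_cat run_c eq_v).
have unkinked := tangle_eq_cat (run_w _ wfu)
                   (tangle_eq_cat eq_kink (run_w _ wfv)).
rewrite -!cats1 -?catA /= in slid; rewrite /= in unkinked.
have := tangle_eq_cat run_t
          (tangle_eq_cat (tangle_eq_trans slid unkinked) run_b).
move/tangle_eq_closed.
rewrite /closure_poly (top_arcsS n.+1) (bottom_arcsS n.+1) -cats1.
move: (top_arcs n.+1) (bottom_arcs n.+1) => T B.
by rewrite !braid_tangle_cat /= -!catA /= -!catA /= => ->.
Qed.

(** * Trivial links *)

Definition reversed_circle : diagram :=
  [:: (0, LocMax false); (0, LocMin false)]%N.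

Let maxes : diagram := [:: (0, LocMax true); (0, LocMax false)]%N.
Let mins : diagram := [:: (0, LocMin false); (0, LocMin true)]%N.
Let four : seq bool := [:: false; true; true; false].

Let far_max : tangle_eq [::] four
  [:: (0, LocMax false); (2, LocMax true)]%N maxes.
Proof. exact: (tangle_eq_far [::] [::] [::] (LocMax false) (LocMax true)). Qed.

Let far_min : tangle_eq four [::]
  mins [:: (2, LocMin true); (0, LocMin false)]%N.
Proof. exact: (tangle_eq_far [::] [::] [::] (LocMin false) (LocMin true)). Qed.

Let left_kink e : tangle_eq [:: true; false] [:: true; false]
  [:: (0, LocMax false); (1, Cross e); (0, LocMin false)]%N [::].
Proof.
exact: (tangle_eq_local [::] [:: false] (s := [:: true]) (t := [:: true])
          (Move_R1_left e)).
Qed.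

Let slice_eq x s t :
  diagram_run [:: x] s = Some t -> tangle_eq s t [:: x] [:: x].
Proof. exact: tangle_eq_refl. Qed.

(** Planar isotopy preserves the rotation number, so Reidemeister I is needed to
    reverse a circle: a figure eight has one loop of each sense, and removing
    either loop leaves a circle that turns like the other. *)
Lemma reversed_circle_eq : tangle_eq [::] [::] reversed_circle circle.
Proof.
have right_kink : tangle_eq [:: false; true] [:: false; true]
    [:: (2, LocMax true); (1, Cross true); (2, LocMin true)]%N [::].
  exact: (tangle_eq_local [:: false] [::] (s := [:: true]) (t := [:: true])
            (Move_R1_right true)).
have cross : tangle_eq four four [:: (1, Cross true)]%N [:: (1, Cross true)]%N.
  exact: slice_eq.
have max_f : tangle_eq [::] [:: false; true]
    [:: (0, LocMax false)]%N [:: (0, LocMax false)]%N by exact: slice_eq.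
have min_f : tangle_eq [:: false; true] [::]
    [:: (0, LocMin false)]%N [:: (0, LocMin false)]%N by exact: slice_eq.
have max_t : tangle_eq [::] [:: true; false]
    [:: (0, LocMax true)]%N [:: (0, LocMax true)]%N by exact: slice_eq.
have min_t : tangle_eq [:: true; false] [::]
    [:: (0, LocMin true)]%N [:: (0, LocMin true)]%N by exact: slice_eq.
have eight :=
  tangle_eq_cat far_max (tangle_eq_cat cross (tangle_eq_sym far_min)).
apply: tangle_eq_trans (tangle_eq_trans eight _).
  exact: tangle_eq_sym (tangle_eq_cat max_f (tangle_eq_cat right_kink min_f)).
exact: tangle_eq_cat max_t (tangle_eq_cat (left_kink true) min_t).
Qed.

(** A positive and a negative kink on a circle have the same value by
    Reidemeister I, and smoothing them splits off a circle; the skein relation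
    between the three diagrams is the claim.  The kink is put on the outer side
    of the strand, so that the split circle is not nested. *)
Lemma homflypt_circle D : link_diagram D ->
  vpow 1 * zpow 1 * P (circle ++ circle ++ D) = (1 - vpow 2) * P (circle ++ D).
Proof.
move=> linkD; have eqD := tangle_eq_refl linkD.
have max_t : tangle_eq [::] [:: true; false]
    [:: (0, LocMax true)]%N [:: (0, LocMax true)]%N by exact: slice_eq.
have min_t : tangle_eq [:: true; false] [::]
    [:: (0, LocMin true)]%N [:: (0, LocMin true)]%N by exact: slice_eq.
have eqDt := tangle_eq_cat min_t eqD.
pose kinked e := maxes ++ (1, Cross e)%N :: mins ++ D.
have kinkedE e : P (kinked e) = P (circle ++ D).
  apply: tangle_eq_closed.
  exact: tangle_eq_cat max_t (tangle_eq_cat (left_kink e) eqDt).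
have splitE : P (maxes ++ mins ++ D) = P (circle ++ circle ++ D).
  apply: tangle_eq_closed.
  have far_maxmin : tangle_eq [:: false; true] [:: true; false]
      [:: (0, LocMin false); (0, LocMax true)]%N
      [:: (2, LocMax true); (0, LocMin false)]%N.
    exact: (tangle_eq_far [::] [::] [::] (LocMin false) (LocMax true)).
  have max_f : tangle_eq [::] [:: false; true]
      [:: (0, LocMax false)]%N [:: (0, LocMax false)]%N by exact: slice_eq.
  have min_f : tangle_eq four [:: true; false]
      [:: (0, LocMin false)]%N [:: (0, LocMin false)]%N by exact: slice_eq.
  apply: tangle_eq_trans
    (tangle_eq_cat (tangle_eq_sym far_max) (tangle_eq_cat min_f eqDt)) _.
  apply: tangle_eq_trans
    (tangle_eq_cat max_f (tangle_eq_cat (tangle_eq_sym far_maxmin) eqDt)) _.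
  exact: tangle_eq_cat reversed_circle_eq (tangle_eq_cat max_t eqDt).
have linkK : link_diagram (kinked true) by [].
have := homflypt_skein hP (A := maxes) (B := mins ++ D) linkK.
rewrite -!/(kinked _) !kinkedE splitE => skein.
by rewrite mulrBl mul1r {1}skein addrK.
Qed.

Lemma trivial_linkE k : P (trivial_link k.+1) = delta ^+ k.
Proof.
have link_trivial m : link_diagram (trivial_link m) by elim: m.
elim: k => [|k IHk]; first by rewrite expr0 -(homflypt_unknot hP).
rewrite exprS -IHk; exact: delta_intro (homflypt_circle (link_trivial k)).
Qed.
End Homflypt.

(** * Reducing words in the symmetric group *)

Lemma split_first (T : eqType) (x : T) s : x \in s ->
  exists p q, s = p ++ x :: q /\ x \notin p.
Proof.
elim: s => //= y s IHs; rewrite inE; have [<- _|neq_xy /= /IHs] := eqVneq x y.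
  by exists [::], s.
by case=> p [q [-> xNp]]; exists (y :: p), q; rewrite inE negb_or neq_xy.
Qed.

Section PositiveWords.
Local Open Scope nat_scope.

(** Words stand for elements of the symmetric group: [Q] holds whenever a square
    occurs, and is invariant under the braid relations. *)
Definition word_closed (Q : seq nat -> Prop) : Prop :=
  [/\ forall u v i, Q (u ++ [:: i; i] ++ v),
      forall u v i j, i.+1 < j ->
        Q (u ++ [:: i; j] ++ v) <-> Q (u ++ [:: j; i] ++ v) &
      forall u v i,
        Q (u ++ [:: i; i.+1; i] ++ v) <-> Q (u ++ [:: i.+1; i; i.+1] ++ v)].

Lemma word_closed_ctx Q u v :
  word_closed Q -> word_closed (fun x => Q (u ++ x ++ v)).
Proof.
case=> Qii Qij Qiji.
split=> [a b i|a b i j lt_ij|a b i]; rewrite -!catA !(catA u).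
- exact: Qii.
- exact: Qij.
exact: Qiji.
Qed.

Lemma word_commute Q u v b n : word_closed Q -> all (fun i => i.+1 < n) b ->
  Q (u ++ n :: b ++ v) <-> Q (u ++ b ++ n :: v).
Proof.
case=> _ Qij _; elim: b u => [|i b IHb] u //= /andP[lt_i /IHb{}IHb].
by rewrite -(Qij u (b ++ v) _ _ lt_i) -!(cat_rcons i).
Qed.

(** Two consecutive occurrences of the highest letter [n] enclose a word in
    smaller letters, and by induction the next letter n - 1 occurs there at most
    once.  If it does not occur, the two n commute together to a square; if it
    does, they commute to n (n - 1) n, and the braid relation leaves one n. *)
Lemma word_reduce n Q : word_closed Q ->
    (forall u, all (ltn^~ n.+1) u -> count_mem n u <= 1 -> Q u) ->
  forall u, all (ltn^~ n.+1) u -> Q u.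
Proof.
elim: n Q => [|n IHn] Q clQ Q1 u.
  have [Qii _ _] := clQ.
  case: u => [|[|i] [|[|j] u]] //= _; [exact: Q1 | exact: Q1 |].
  exact: (Qii [::]).
have [k le_k] := ubnP (count_mem n.+1 u).
elim: k u le_k => // k IHk u le_k ltu.
have [|lt1u] := leqP (count_mem n.+1 u) 1; first exact: Q1.
have /split_first[a [v [def_u aN]]] : n.+1 \in u.
  by rewrite -has_pred1 has_count; lia.
have /split_first[b [c [def_v bN]]] : n.+1 \in v.
  rewrite -has_pred1 has_count; move: lt1u.
  by rewrite def_u count_cat (count_memPn aN) /= eqxx add0n add1n ltnS.
rewrite def_v in def_u; move: ltu le_k; rewrite {}def_u => {u lt1u aN def_v v}.
rewrite all_cat /= all_cat /= => /and5P[lta _ ltb _ ltc].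
rewrite count_cat /= count_cat /= eqxx => lt_k.
have {lt_k}lt_ac : count_mem n.+1 a + count_mem n.+1 c + 1 < k.
  by move: lt_k; move: (count _ a) (count _ b) (count _ c) => x y z; lia.
suff: Q ((a ++ [:: n.+1]) ++ b ++ n.+1 :: c) by rewrite -catA.
have ltb' : all (ltn^~ n.+1) b.
  apply/allP => i bi; have /= := allP ltb i bi; rewrite ltnS leq_eqVlt.
  by case: eqP => // eq_i; rewrite -eq_i bi in bN.
pose Q' x := Q ((a ++ [:: n.+1]) ++ x ++ n.+1 :: c).
apply: (IHn Q' (word_closed_ctx _ _ clQ)) (ltb') => {ltb ltb' bN b} b ltb le1b.
rewrite /Q'; have [_ _ Qiji] := clQ; have [Qii _ _] := clQ.
have [n_b|nNb] := boolP (n \in b); last first.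
  have ltb' : all (fun i => i.+1 < n.+1) b.
    apply/allP => i bi; have := allP ltb i bi; rewrite /= ltnS leq_eqVlt.
    by case: eqP => // eq_i; rewrite -eq_i bi in nNb.
  rewrite -catA (word_commute _ _ clQ ltb') catA; exact: Qii.
have [b1 [b2 [def_b nNb1]]] := split_first n_b.
have nNb2 : n \notin b2.
  apply/count_memPn; move: le1b; rewrite def_b count_cat (count_memPn nNb1) /=.
  by rewrite eqxx; lia.
have lt_b12 x : {subset x <= b} -> n \notin x -> all (fun i => i.+1 < n.+1) x.
  move=> sub_x nNx; apply/allP => i xi; have := allP ltb i (sub_x i xi).
  by rewrite /= ltnS leq_eqVlt; case: eqP => // eq_i; rewrite -eq_i xi in nNx.
have lt_b1 : all (fun i => i.+1 < n.+1) b1.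
  by apply: lt_b12 nNb1 => i i_b1; rewrite def_b mem_cat i_b1.
have lt_b2 : all (fun i => i.+1 < n.+1) b2.
  by apply: lt_b12 nNb2 => i i_b2; rewrite def_b mem_cat inE i_b2 !orbT.
rewrite -catA def_b -catA (word_commute _ _ clQ lt_b1) /=.
have -> : a ++ b1 ++ [:: n.+1, n & b2 ++ n.+1 :: c] =
          (a ++ b1 ++ [:: n.+1; n]) ++ b2 ++ n.+1 :: c by rewrite -!catA.
rewrite -(word_commute _ c clQ lt_b2).
have -> : (a ++ b1 ++ [:: n.+1; n]) ++ n.+1 :: b2 ++ c =
          (a ++ b1) ++ [:: n.+1; n; n.+1] ++ (b2 ++ c) by rewrite -!catA.
have ltS x : all (fun i => i.+1 < n.+1) x -> all (ltn^~ n.+2) x.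
  by move=> ltx; apply: sub_all ltx => i /= lt_i; lia.
rewrite -Qiji; apply: IHk.
  have no_top x : all (fun i => i.+1 < n.+1) x -> count_mem n.+1 x = 0.
    move=> ltx; apply/count_memPn/negP => /(allP ltx) /=.
    by rewrite ltnNge leqnSn.
  rewrite !count_cat /= eqxx (no_top _ lt_b1) (no_top _ lt_b2).
  rewrite (ltn_eqF (ltnSn n)); move: lt_ac.
  by move: (count _ a) (count _ c) => x y; lia.
by rewrite !all_cat /= !ltnS leqnn leqnSn lta ltc (ltS _ lt_b1) (ltS _ lt_b2).
Qed.
End PositiveWords.

(** * Skein induction on closed braids *)

Section ClosedBraidInduction.
Variables (P : diagram -> laurent2) (hP : homflypt P).

Definition crossing_sign (e : bool) : int := if e then 1 else -1.

Definition exponent_sum (w : seq (nat * bool)) : int :=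
  \sum_(x <- w) crossing_sign x.2.

Lemma exponent_sum_cat u v :
  exponent_sum (u ++ v) = exponent_sum u + exponent_sum v.
Proof. exact: big_cat. Qed.

Lemma exponent_sum_cons x v :
  exponent_sum (x :: v) = crossing_sign x.2 + exponent_sum v.
Proof. exact: big_cons. Qed.

(** Compare the two stabilizations of [w] by the skein relation. *)
Lemma closure_split n w : braid_word n.+1 w ->
  closure_poly P n.+2 w = delta * closure_poly P n.+1 w.
Proof.
move=> wfw; apply: delta_intro.
have wfw' : braid_word n.+2 (w ++ [:: (n, true)]).
  rewrite /braid_word all_cat /= ltnSn !andbT.
  by apply/allP => x /(allP wfw)/leqW.
have stab e : closure_poly P n.+2 (w ++ [:: (n, e)]) = closure_poly P n.+1 w.
  by rewrite (closure_stabilize hP e wfw (v := [::]) isT) cats0.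
have := closure_skein hP wfw'; rewrite !stab cats0.
move: (closure_poly P _ _) (closure_poly P _ _) => p q.
move: (_ * zpow 1) (vpow 2) => a b skein.
by rewrite mulrBl mul1r {1}skein addrK.
Qed.

(** [Phi n w p] is read as a property of the polynomial p of a closed n-braid
    of writhe w. *)
Variable Phi : nat -> int -> laurent2 -> Prop.
Hypothesis Phi_unknot : Phi 1 0 1.
Hypothesis Phi_pos : forall n w p q,
  Phi n w p -> Phi n (w - 1) q ->
  Phi n (w + 1) (vpow 1 * zpow 1 * p + vpow 2 * q).
Hypothesis Phi_neg : forall n w p q,
  Phi n w p -> Phi n (w + 1) q ->
  Phi n (w - 1) (vpow (-2) * (q - vpow 1 * zpow 1 * p)).
Hypothesis Phi_stab : forall n w p e,
  Phi n w p -> Phi n.+1 (w + crossing_sign e) p.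
Hypothesis Phi_split : forall n w p,
  Phi n w p -> Phi n.+1 w (delta * p).

Let holds n w := Phi n (exponent_sum w) (closure_poly P n w).

Lemma holds_switch n u v i e : braid_word n (u ++ (i, e) :: v) ->
  holds n (u ++ v) -> holds n (u ++ (i, ~~ e) :: v) ->
  holds n (u ++ (i, e) :: v).
Proof.
move=> wf; have wf' : braid_word n (u ++ (i, true) :: v).
  by move: wf; rewrite /braid_word !all_cat.
have := closure_skein hP wf'.
rewrite /holds !exponent_sum_cat !exponent_sum_cons /=.
move: (exponent_sum u) (exponent_sum v) => a b skein.
case: e {wf} => H0 H1.
  have := Phi_pos H0; rewrite skein (_ : a + (_ + b) = a + b + 1); last first.
    by rewrite addrCA addrC.
  by apply; rewrite (_ : a + b - 1 = a + (- 1 + b)) // addrCA addrC.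
have -> : closure_poly P n (u ++ (i, false) :: v) =
    vpow (-2) * (closure_poly P n (u ++ (i, true) :: v) -
                 vpow 1 * zpow 1 * closure_poly P n (u ++ v)).
  rewrite skein addrC addKr mulrA -vpowD.
  by rewrite (_ : vpow _ = 1) // mul1r.
have := Phi_neg H0; rewrite (_ : a + (_ + b) = a + b - 1); last first.
  by rewrite addrCA addrC.
by apply; rewrite (_ : a + b + 1 = a + (1 + b)) // addrCA addrC.
Qed.

(** A crossing change costs a smoothing, which is a shorter word. *)
Lemma holds_signs n k u w w' :
    (forall x, (size x < k)%N -> braid_word n x -> holds n x) ->
    size (u ++ w) = k -> braid_word n (u ++ w) -> unzip1 w = unzip1 w' ->
  holds n (u ++ w) -> holds n (u ++ w').
Proof.
move=> IHk; elim: w w' u => [|[i e] w IHw] [|[i' e'] w'] u //=.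
move=> size_w wf [<- eq_w] hw; rewrite -cat_rcons.
apply: IHw => //; rewrite ?cat_rcons.
- by rewrite -size_w !size_cat.
- by move: wf; rewrite /braid_word !all_cat.
have [<- //|neq_e] := eqVneq e e'.
have -> : e' = ~~ e by case: e e' neq_e {hw wf size_w} => [] [].
apply: holds_switch; rewrite ?negbK //.
  by move: wf; rewrite /braid_word !all_cat.
apply: IHk; first by rewrite -size_w !size_cat addnS.
by move: wf; rewrite /braid_word !all_cat => /and3P[-> _ wfw]; apply: wfw.
Qed.

Definition positive (x : seq nat) := [seq (i, true) | i <- x].

Lemma positiveK : cancel positive unzip1.
Proof. by move=> x; rewrite /unzip1 -map_comp map_id_in. Qed.

Let unzip1_cat (x y : seq (nat * bool)) :
  unzip1 (x ++ y) = unzip1 x ++ unzip1 y.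
Proof. exact: map_cat. Qed.

Lemma positive_cat x y : positive (x ++ y) = positive x ++ positive y.
Proof. exact: map_cat. Qed.

Lemma exponent_sum_positive x : exponent_sum (positive x) = (size x)%:Z.
Proof.
elim: x => [|i x IHx]; first exact: big_nil.
by rewrite exponent_sum_cons IHx /= -PoszD add1n.
Qed.

(** Induction on the number of strands, then on the length of the word.  Once
    shorter words are settled, signs of crossings can be changed freely, so two
    equal adjacent generators cancel to a shorter word and [word_reduce]
    applies; a word with at most one crossing between the last two strands is
    a stabilization or has a split circle. *)
Theorem closed_braid_ind n w :
  braid_word n.+1 w -> Phi n.+1 (exponent_sum w) (closure_poly P n.+1 w).
Proof.
rewrite -/(holds _ _).
elim: n w => [|n IHn] w.
  case: w => // _; rewrite /holds /exponent_sum big_nil.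
  by have -> : closure_poly P 1 [::] = 1 by exact: homflypt_unknot hP.
move: {2}(size w) (leqnn (size w)) => k.
elim/ltn_ind: k w => k IHk w size_w wfw.
have {IHk size_w}IHk x :
    (size x < size w)%N -> braid_word n.+2 x -> holds n.+2 x.
  by move=> lt_x; apply: IHk (leqnn _); apply: leq_trans lt_x size_w.
have {k}[k size_w] : exists k, size w = k by exists (size w).
rewrite size_w in IHk.
have wf_word x : braid_word n.+2 x = all (ltn^~ n.+1) (unzip1 x).
  by rewrite all_map.
pose Q x := size x = k -> all (ltn^~ n.+1) x -> holds n.+2 (positive x).
have Q_signs x y : size (unzip1 x) = k -> unzip1 x = unzip1 y ->
  braid_word n.+2 x -> holds n.+2 x -> holds n.+2 y.
  rewrite size_map => size_x eq_xy wfx.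
  exact: (@holds_signs _ k [::] x y IHk size_x wfx eq_xy).
have ltw : all (ltn^~ n.+1) (unzip1 w) by rewrite -wf_word.
have Q_move u v s t : size s = size t ->
    all (ltn^~ n.+1) s = all (ltn^~ n.+1) t ->
    (braid_word n.+2 (positive u ++ positive v) -> all (ltn^~ n.+1) s ->
     closure_poly P n.+2 (positive u ++ positive s ++ positive v) =
     closure_poly P n.+2 (positive u ++ positive t ++ positive v)) ->
    Q (u ++ s ++ v) -> Q (u ++ t ++ v).
  move=> eq_size eq_all eq_closure Qs size_t lt_t.
  move: Qs; rewrite /Q !size_cat eq_size -!size_cat => /(_ size_t).
  rewrite !all_cat eq_all -!all_cat => /(_ lt_t).
  rewrite /holds !positive_cat eq_closure.
  - by rewrite !exponent_sum_cat !exponent_sum_positive eq_size.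
  - move: lt_t; rewrite wf_word unzip1_cat !positiveK !all_cat.
    by move=> /and3P[-> _ ->].
  by move: lt_t; rewrite !all_cat eq_all => /and3P[].
suff Qw : Q (unzip1 w).
  apply: (Q_signs (positive (unzip1 w)));
    rewrite ?wf_word ?positiveK ?size_map //.
  by apply: Qw; rewrite ?size_map.
apply: (@word_reduce n); last exact: ltw.
  split=> [u v i|u v i j lt_ij|u v i].
  - move=> size_x; rewrite !all_cat /= => /and3P[ltu /andP[lt_i _] ltv].
    have wfuv : braid_word n.+2 (positive u ++ positive v).
      by rewrite wf_word unzip1_cat !positiveK all_cat ltu.
    apply: (Q_signs (positive u ++ [:: (i, true); (i, false)] ++ positive v)).
    + by rewrite !unzip1_cat !positiveK.
    + by rewrite !unzip1_cat !positiveK.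
    + by rewrite wf_word !unzip1_cat !positiveK !all_cat /= ltu lt_i.
    rewrite /holds (closure_cancel hP) //.
    rewrite exponent_sum_cat /= !exponent_sum_cons /= addNKr -exponent_sum_cat.
    apply: IHk wfuv; move: size_x; rewrite !size_cat !size_map /=; lia.
  - have commuted x y : (x.+1 < y)%N \/ (y.+1 < x)%N ->
        Q (u ++ [:: x; y] ++ v) -> Q (u ++ [:: y; x] ++ v).
      move=> lt_xy; apply: Q_move => // [|wfuv].
        by rewrite /= !andbT andbC.
      rewrite /= andbT => /andP[lt_x lt_y].
      case: lt_xy => lt_xy; first exact: (closure_commute hP).
      by symmetry; exact: (closure_commute hP).
    by split; apply: commuted; [left | right].
  have wf_i : all (ltn^~ n.+1) [:: i; i.+1; i] =
              all (ltn^~ n.+1) [:: i.+1; i; i.+1].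
    by rewrite /= !andbT; do 2!case: (_ < _)%N.
  split; apply: Q_move => // wfuv /and4P[lt_i lt_i1 lt_i' _]; last symmetry.
    exact: (closure_braid hP).
  exact: (closure_braid hP).
move=> u ltu le1 _ _.
have wf_below x :
    n \notin x -> all (ltn^~ n.+1) x -> braid_word n.+1 (positive x).
  move=> nNx ltx; rewrite /braid_word all_map; apply/allP => i xi /=.
  have := allP ltx i xi; rewrite /= ltnS leq_eqVlt ltnS.
  by case: eqP => // eq_i; rewrite -eq_i xi in nNx.
have [n_u|nNu] := boolP (n \in u); last first.
  have wfu := wf_below u nNu ltu.
  rewrite /holds closure_split //; exact: Phi_split (IHn _ wfu).
have [a [b [def_u nNa]]] := split_first n_u.
move: le1 ltu; rewrite def_u count_cat (count_memPn nNa) /= eqxx.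
rewrite add0n add1n ltnS leqn0.
move/eqP/count_memPn => nNb; rewrite all_cat => /and3P[lta _ ltb].
have wfa := wf_below a nNa lta; have wfb := wf_below b nNb ltb.
have wfab : braid_word n.+1 (positive a ++ positive b).
  by rewrite /braid_word all_cat; apply/andP.
rewrite /holds positive_cat closure_stabilize //.
rewrite exponent_sum_cat exponent_sum_cons addrCA addrC -exponent_sum_cat.
exact: Phi_stab (IHn _ wfab).
Qed.
End ClosedBraidInduction.


(** * Coefficients of Laurent polynomials *)

Section LaurentCoefficients.
Variable R : comNzRingType.
Implicit Types f g : laurent R.

Lemma laurentP f g : (forall i, f@_i = g@_i) -> f = g.
Proof. by move=> eq_fg; apply/malgP. Qed.

Lemma coefMU (c : R) k f i : (laurent_mul << c *g k >> f)@_i = c * f@_(i - k).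
Proof.
rewrite (laurent_mulw msuppU_le (fsubset_refl _)) big_seq_fset1 raddf_sum /=.
under eq_bigr => j _ do rewrite mcoeffUU mcoeffU.
have eqE j : (k + j == i) = (j == i - k) by lia.
have [ik_f|ikNf] := boolP (i - k \in msupp f).
  rewrite (big_fsetD1 _ ik_f) /= eqE eqxx mulr1n big1_fset ?addr0 //.
  by move=> j; rewrite !inE eqE => /andP[/negbTE-> _] _; rewrite mulr0n.
rewrite (mcoeff_outdom ikNf) mulr0 big1_fset // => j jf _; rewrite eqE.
by case: eqP => [eq_j|]; rewrite ?mulr0n // -eq_j jf in ikNf *.
Qed.

Definition support_bound f : int := \sum_(i <- msupp f) `|i|.

Lemma support_bound_ge0 f : 0 <= support_bound f.
Proof. by apply: sumr_ge0. Qed.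

Lemma support_boundP f i : f@_i != 0 -> `|i| <= support_bound f.
Proof.
rewrite mcoeff_neq0 => fi; rewrite /support_bound (big_fsetD1 i) //=.
by rewrite lerDl sumr_ge0.
Qed.
End LaurentCoefficients.

Lemma coef_vpow k (p : laurent2) i : (vpow k * p)@_i = p@_(i - k).
Proof. by rewrite [LHS]coefMU; apply: (@mul1r (laurent int)). Qed.

Lemma coef_zpow k (p : laurent2) i e : (zpow k * p)@_i@_e = p@_i@_(e - k).
Proof.
rewrite [X in X@__]coefMU subr0.
by rewrite [LHS]coefMU mul1r.
Qed.

(** Elements of [laurent2] are polynomials in v over those in z; this is the
    coefficient of z^e, a Laurent polynomial in v. *)
Definition zcoef (p : laurent2) (e : int) : laurent int :=
  \sum_(i <- msupp p) << (p@_i)@_e *g i >>.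

Lemma zcoefE p e i : (zcoef p e)@_i = p@_i@_e.
Proof.
rewrite raddf_sum /=; have [i_p|iNp] := boolP (i \in msupp p).
  rewrite (big_fsetD1 _ i_p) /= mcoeffUU big1_fset ?addr0 // => j.
  by rewrite !inE mcoeffU => /andP[/negbTE-> _] _; rewrite mulr0n.
rewrite (mcoeff_outdom iNp) mcoeff0 big1_fset // => j jp _; rewrite mcoeffU.
by case: eqP => [eq_j|]; rewrite ?mulr0n // -eq_j jp in iNp *.
Qed.

Lemma zcoefP p q : (forall e, zcoef p e = zcoef q e) -> p = q.
Proof.
move=> eq_pq; apply: laurentP => i; apply: laurentP => e.
by rewrite -!zcoefE eq_pq.
Qed.

Lemma zcoefD p q e : zcoef (p + q) e = zcoef p e + zcoef q e.
Proof.
apply: laurentP => i; rewrite mcoeffD !zcoefE.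
by rewrite [X in X@__]mcoeffD mcoeffD.
Qed.

Lemma zcoefN p e : zcoef (- p) e = - zcoef p e.
Proof.
apply: laurentP => i; rewrite mcoeffN !zcoefE.
by rewrite [X in X@__]mcoeffN mcoeffN.
Qed.

Lemma zcoefB p q e : zcoef (p - q) e = zcoef p e - zcoef q e.
Proof. by rewrite zcoefD zcoefN. Qed.

Lemma zcoef1 e : zcoef 1 e = (e == 0)%:R.
Proof.
apply: laurentP => i; rewrite zcoefE [X in X@__]mcoeffU.
rewrite mcoeffMn mcoeffU eq_sym; case: eqP => _; last by rewrite mul0rn mcoeff0.
by rewrite [RHS]mcoeffU.
Qed.

(** The power v^k as it occurs in the coefficients [zcoef p e]. *)
Definition tpow (k : int) : laurent int := << 1 *g k >>.

Lemma tpowD i j : tpow (i + j) = tpow i * tpow j.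
Proof. by rewrite [RHS]laurent_mulUU mulr1. Qed.

Lemma coef_tpow k (f : laurent int) i : (tpow k * f)@_i = f@_(i - k).
Proof. by rewrite [LHS]coefMU mul1r. Qed.

Lemma zcoef_vpow k p e : zcoef (vpow k * p) e = tpow k * zcoef p e.
Proof. by apply: laurentP => i; rewrite zcoefE coef_vpow coef_tpow zcoefE. Qed.

Lemma zcoef_zpow k p e : zcoef (zpow k * p) e = zcoef p (e - k).
Proof. by apply: laurentP => i; rewrite !zcoefE coef_zpow. Qed.

Lemma zcoef_delta p e :
  zcoef (delta * p) e = tpow (-1) * ((1 - tpow 2) * zcoef p (e + 1)).
Proof.
rewrite deltaE -mulrA zcoef_vpow zcoef_zpow opprK.
by rewrite mulrBl mul1r zcoefB zcoef_vpow mulrBl mul1r.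
Qed.

(** * Three properties of the polynomials of closed braids *)

(** Every polynomial expression in v, 1/v, z and delta has this property, since
    delta^b z^a contributes (1/v - v)^b to the coefficient of z^(a - b). *)
Definition tdivisible (p : laurent2) : Prop :=
  forall k : nat, exists r, zcoef p (- k%:Z) = (1 - tpow 2) ^+ k * r.

Lemma tdivisibleD p q : tdivisible p -> tdivisible q -> tdivisible (p + q).
Proof.
move=> divp divq k; have [[r pr] [s qs]] := (divp k, divq k).
by exists (r + s); rewrite zcoefD pr qs mulrDr.
Qed.

Lemma tdivisibleN p : tdivisible p -> tdivisible (- p).
Proof.
move=> divp k; have [r pr] := divp k; exists (- r).
by rewrite zcoefN pr mulrN.
Qed.

Lemma tdivisible_vpow a p : tdivisible p -> tdivisible (vpow a * p).
Proof.
move=> divp k; have [r pr] := divp k; exists (tpow a * r).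
by rewrite zcoef_vpow pr mulrCA.
Qed.

Lemma tdivisible_zpow p : tdivisible p -> tdivisible (zpow 1 * p).
Proof.
move=> divp k; have [r pr] := divp k.+1; exists ((1 - tpow 2) * r).
rewrite zcoef_zpow mulrA -exprSr -pr; congr zcoef; lia.
Qed.

Lemma mul_rearrange (R : comNzRingType) (a b c r : R) :
  b * (a * (c * r)) = a * c * (b * r).
Proof. by ring. Qed.

Lemma tdivisible_delta p : tdivisible p -> tdivisible (delta * p).
Proof.
move=> divp [|k]; first by eexists; rewrite expr0 mul1r.
have [r pr] := divp k; exists (tpow (-1) * r); rewrite zcoef_delta.
rewrite (_ : - k.+1%:Z + 1 = - k%:Z); last by lia.
rewrite pr exprS; exact: mul_rearrange.
Qed.

Lemma tdivisible1 : tdivisible 1.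
Proof.
case=> [|k]; first by eexists; rewrite expr0 mul1r.
by exists 0; rewrite zcoef1 mulr0.
Qed.

(** The substitution z = 1/v - v, that is v^2 + v z - 1 = 0, maps p to 1.
    Stating this as a congruence modulo the ideal of v^2 + v z - 1 avoids
    inverting 1/v - v. *)
Definition specializes_to1 (p : laurent2) : Prop :=
  exists q, p - 1 = (vpow 2 + vpow 1 * zpow 1 - 1) * q.

Lemma ideal_pos (R : comNzRingType) (s t p q a b : R) :
  let f := t + s - 1 in p - 1 = f * a -> q - 1 = f * b ->
  s * p + t * q - 1 = f * (s * a + t * b + 1).
Proof.
move=> f /(canRL (subrK 1))-> /(canRL (subrK 1))->; rewrite /f; ring.
Qed.

Lemma ideal_neg (R : comNzRingType) (s t t' p q a b : R) :
  let f := t + s - 1 in t' * t = 1 -> p - 1 = f * a -> q - 1 = f * b ->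
  t' * (q - s * p) - 1 = f * (t' * (b - s * a - 1)).
Proof.
move=> f tK /(canRL (subrK 1))-> /(canRL (subrK 1))->.
by rewrite -[X in _ - X]tK /f; ring.
Qed.

Lemma ideal_split (R : comNzRingType) (v v' z z' t p a : R) :
  let f := t + v * z - 1 in v' * v = 1 -> z' * z = 1 -> p - 1 = f * a ->
  v' * z' * ((1 - t) * p) - 1 = f * (v' * z' * ((1 - t) * a - 1)).
Proof.
move=> f vK zK /(canRL (subrK 1))->.
transitivity (v' * z' * ((1 - t) * (f * a + 1)) - (v' * v) * (z' * z)).
  by rewrite vK zK mulr1.
rewrite /f; ring.
Qed.

Lemma specializes_delta p : specializes_to1 p -> specializes_to1 (delta * p).
Proof.
case=> a pa; exists (vpow (-1) * zpow (-1) * ((1 - vpow 2) * a - 1)).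
apply: etrans (congr1 (fun x : laurent2 => x - 1) (deltaE p)) _.
exact: (@ideal_split laurent2 _ _ _ _ (vpow 2) p a (vpowVK 1) (zpowVK 1) pa).
Qed.

Section BraidPolynomials.
Variables (P : diagram -> laurent2) (hP : homflypt P).

Lemma closed_braid_specializes n w :
  braid_word n.+1 w -> specializes_to1 (closure_poly P n.+1 w).
Proof.
apply: (closed_braid_ind hP (Phi := fun _ _ p => specializes_to1 p)) => {n w}.
- by exists 0; rewrite subrr mulr0.
- move=> _ _ p q [a pa] [b qb].
  exists (vpow 1 * zpow 1 * a + vpow 2 * b + 1).
  exact: (@ideal_pos laurent2 (vpow 1 * zpow 1) (vpow 2) p q a b pa qb).
- move=> _ _ p q [a pa] [b qb].
  have vK : vpow (-2) * vpow 2 = 1 by rewrite -vpowD.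
  exists (vpow (-2) * (b - vpow 1 * zpow 1 * a - 1)).
  exact: (@ideal_neg laurent2 (vpow 1 * zpow 1) (vpow 2) _ p q a b vK pa qb).
- by [].
move=> _ _ p; exact: specializes_delta.
Qed.

Lemma closed_braid_tdivisible n w :
  braid_word n.+1 w -> tdivisible (closure_poly P n.+1 w).
Proof.
apply: (closed_braid_ind hP (Phi := fun _ _ p => tdivisible p)) => {n w}.
- exact: tdivisible1.
- move=> _ _ p q divp divq; rewrite -mulrA.
  apply: tdivisibleD (tdivisible_vpow 2 divq).
  exact/tdivisible_vpow/tdivisible_zpow.
- move=> _ _ p q divp divq; rewrite -mulrA; apply: tdivisible_vpow.
  by apply/(tdivisibleD divq)/tdivisibleN/tdivisible_vpow/tdivisible_zpow.
- by [].
move=> _ _ p; exact: tdivisible_delta.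
Qed.

Definition mfw_bound (n : nat) (w : int) (p : laurent2) : Prop :=
  forall i, p@_i != 0 ->
    exists2 j : nat, (j < n)%N & i = w - n%:Z + 1 + j.*2%:Z.

Lemma coef_zpow_neq0 k p i : (zpow k * p)@_i != 0 -> (p : laurent2)@_i != 0.
Proof.
apply: contra_neq => pi0; apply: laurentP => e.
rewrite coef_zpow mcoeff0.
exact: etrans (congr1 (fun f : laurent int => f@_(e - k)) pi0) (mcoeff0 _).
Qed.

Lemma coefD_neq0 (p q : laurent2) i : (p + q)@_i != 0 -> p@_i != 0 \/ q@_i != 0.
Proof.
move=> pq; have [p0|] := eqVneq p@_i 0; last by left.
right; apply: contra_neq pq => q0; rewrite mcoeffD.
exact: etrans (congr2 +%R p0 q0) (addr0 _).
Qed.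

Lemma coefN_neq0 (p : laurent2) i : (- p)@_i != 0 -> p@_i != 0.
Proof. by rewrite mcoeffN oppr_eq0. Qed.

(** The Morton-Franks-Williams inequality: the v-degrees lie between w - n + 1
    and w + n - 1.  A crossing change moves w and the degrees by 2 and a
    smoothing moves both by 1, so the skein relation preserves the bound. *)
Lemma closed_braid_mfw n w :
  braid_word n.+1 w -> mfw_bound n.+1 (exponent_sum w) (closure_poly P n.+1 w).
Proof.
apply: (closed_braid_ind hP (Phi := mfw_bound)) => {n w}.
- move=> i; have [->|neq_i] := eqVneq i 0; first by exists 0%N.
  have {}neq_i : (0 == i) = false by rewrite eq_sym (negbTE neq_i).
  by rewrite mcoeffU [_ == i]neq_i mulr0n eqxx.
- move=> n w p q bp bq i /coefD_neq0[].
    rewrite -mulrA coef_vpow => /coef_zpow_neq0/bp[j lt_j def_i]; exists j; lia.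
  rewrite coef_vpow => /bq[j lt_j def_i]; exists j; lia.
- move=> n w p q bp bq i; rewrite coef_vpow => /coefD_neq0[].
    move=> /bq[j lt_j def_i]; exists j; lia.
  move/coefN_neq0; rewrite -mulrA coef_vpow => /coef_zpow_neq0/bp[j lt_j def_i].
  exists j; lia.
- move=> n w p [] bp i /bp[j lt_j def_i]; rewrite /crossing_sign.
    exists j; lia.
  exists j.+1; lia.
move=> n w p bp i; rewrite deltaE -mulrA coef_vpow => /coef_zpow_neq0.
rewrite mulrBl mul1r => /coefD_neq0[/bp[j lt_j def_i]|].
  exists j; lia.
move/coefN_neq0; rewrite coef_vpow => /bp[j lt_j def_i]; exists j.+1; lia.
Qed.
End BraidPolynomials.

(** * Supports of multiples of 1 - v^2 and of v^2 + v z - 1 *)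

(** All arguments about finite supports below are of this form: a nonzero
    coefficient would force another one farther out. *)
Lemma no_infinite_ascent (T : Type) (A : T -> Prop) (mu : T -> int) (N : int) :
    (forall x, A x -> mu x <= N) ->
    (forall x, A x -> exists2 y, A y & mu x < mu y) ->
  forall x, ~ A x.
Proof.
move=> bound step x Ax.
have [k le_k] : exists k : nat, N - mu x < k%:Z by exists `|N - mu x|.+1; lia.
elim: k x Ax le_k => [|k IHk] x Ax le_k; first by have := bound x Ax; lia.
by have [y Ay lt_xy] := step x Ax; apply: (IHk y Ay); lia.
Qed.

Lemma coef_1Bt2 (r : laurent int) i : ((1 - tpow 2) * r)@_i = r@_i - r@_(i - 2).
Proof. by rewrite mulrBl mul1r mcoeffB coef_tpow. Qed.

(** Outside of [lo, hi] the coefficients of r are 2-periodic, hence zero. *)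
Lemma support_factor (r : laurent int) lo hi :
    (forall i, ((1 - tpow 2) * r)@_i != 0 -> lo <= i <= hi) ->
  forall i, r@_i != 0 -> lo <= i <= hi - 2.
Proof.
move=> supp i; have bound := @support_boundP _ r => ri.
have above j : hi - 2 < j -> r@_j = 0.
  move=> lt_j; apply/eqP/negPn/negP => rj.
  pose A j := hi - 2 < j /\ r@_j != 0.
  apply: (@no_infinite_ascent int A id (support_bound r) _ _ j) => //.
    by move=> {lt_j rj}j [_ /bound]; lia.
  move=> {lt_j rj}j [lt_j rj]; exists (j + 2) => /=; last by lia.
  split; first by lia.
  have : ((1 - tpow 2) * r)@_(j + 2) = 0.
    by apply/eqP/negPn/negP => /supp; lia.
  by rewrite coef_1Bt2 addrK => /subr0_eq->.
have below j : j < lo -> r@_j = 0.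
  move=> lt_j; apply/eqP/negPn/negP => rj.
  pose A j := j < lo /\ r@_j != 0.
  apply: (@no_infinite_ascent int A -%R (support_bound r) _ _ j) => //.
    by move=> {lt_j rj}j [_ /bound]; lia.
  move=> {lt_j rj}j [lt_j rj]; exists (j - 2) => /=; last by lia.
  split; first by lia.
  have : ((1 - tpow 2) * r)@_j = 0 by apply/eqP/negPn/negP => /supp; lia.
  by rewrite coef_1Bt2 => /subr0_eq <-.
apply/andP; split; rewrite leNgt; apply: contra_neqN ri; first exact: below.
exact: above.
Qed.

Lemma support_factorX (r : laurent int) lo hi k :
    (forall i, ((1 - tpow 2) ^+ k * r)@_i != 0 -> lo <= i <= hi) ->
  forall i, r@_i != 0 -> lo <= i <= hi - k.*2%:Z.
Proof.
elim: k hi => [|k IHk] hi supp i ri.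
  by rewrite subr0; apply: supp; rewrite expr0 mul1r.
have -> : hi - k.+1.*2%:Z = hi - 2 - k.*2%:Z by lia.
apply: (IHk _ _ i ri); apply: support_factor => j.
by rewrite mulrA -exprS; apply: supp.
Qed.

(** The function g is the product of q with a v^2 + b v z + c, and a
    monomial v^i z^e has weight i + e.  The top part of the product is
    (a v^2 + b v z) times the top part of q, and a v^2 + b v z is not a
    monomial, so the top part of g is not a monomial either. *)
Lemma top_weight_vanishes (g q : int -> int -> int) (a b c N D i0 e0 : int) :
    a != 0 -> b != 0 ->
    (forall i e, q i e != 0 -> i <= N /\ e <= N) ->
    (forall i e, g i e = a * q (i - 2) e + b * q (i - 1) (e - 1) + c * q i e) ->
    (forall i e, g i e != 0 -> i + e <= D /\ (i + e = D -> e = e0)) ->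
  i0 + e0 = D -> g i0 e0 = 0.
Proof.
move=> a0 b0 bound gE supp def_D.
have g0 i e : (D < i + e) || (i + e == D) && (e != e0) -> g i e = 0.
  by move=> out; apply/eqP/negPn/negP => /supp[]; lia.
have above i e : D - 2 < i + e -> q i e = 0.
  move=> lt_D; apply/eqP/negPn/negP => q_ie.
  pose A x := D - 2 < x.1 + x.2 /\ q x.1 x.2 != 0.
  apply: (@no_infinite_ascent _ A fst N _ _ (i, e)) => // {i e lt_D q_ie}
    [[i e]|[i e]] [/= lt_D q_ie].
    by have [] := bound i e q_ie.
  have := gE (i + 2) e; rewrite g0; last by lia.
  rewrite addrK (_ : i + 2 - 1 = i + 1); last by lia.
  have [q1 |q1] := eqVneq (q (i + 1) (e - 1)) 0; last first.
    by move=> _; exists (i + 1, e - 1); rewrite /A /=; [split=> //|]; lia.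
  have [q2 |q2] := eqVneq (q (i + 2) e) 0; last first.
    by move=> _; exists (i + 2, e); rewrite /A /=; [split=> //|]; lia.
  move/eqP; rewrite q1 q2 !mulr0 !addr0 eq_sym mulf_eq0.
  by rewrite (negbTE a0) (negbTE q_ie).
have lower i e : i + e = D - 2 -> e < e0 -> q i e = 0.
  move=> eq_D lt_e; apply/eqP/negPn/negP => q_ie.
  pose A x := [/\ x.1 + x.2 = D - 2, x.2 < e0 & q x.1 x.2 != 0].
  apply: (@no_infinite_ascent _ A fst N _ _ (i, e)) => // {i e eq_D lt_e q_ie}
    [[i e]|[i e]] [/= eq_D lt_e q_ie].
    by have [] := bound i e q_ie.
  exists (i + 1, e - 1); rewrite /A /=; last by lia.
  split; [lia | lia |].
  have := gE (i + 2) e; rewrite g0; last by lia.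
  rewrite addrK (_ : i + 2 - 1 = i + 1) ?(above (i + 2)); [|lia..].
  apply: contra_eq_neq => ->; rewrite !mulr0 !addr0 eq_sym.
  by rewrite mulf_neq0.
have upper i e : i + e = D - 2 -> e0 <= e -> q i e = 0.
  move=> eq_D le_e; apply/eqP/negPn/negP => q_ie.
  pose A x := [/\ x.1 + x.2 = D - 2, e0 <= x.2 & q x.1 x.2 != 0].
  apply: (@no_infinite_ascent _ A snd N _ _ (i, e)) => // {i e eq_D le_e q_ie}
    [[i e]|[i e]] [/= eq_D le_e q_ie].
    by have [] := bound i e q_ie.
  exists (i - 1, e + 1); rewrite /A /=; last by lia.
  split; [lia | lia |].
  have := gE (i + 1) (e + 1); rewrite g0; last by lia.
  rewrite !addrK (_ : i + 1 - 2 = i - 1) ?(above (i + 1)); [|lia..].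
  apply: contra_eq_neq => ->; rewrite !mulr0 !addr0 add0r eq_sym.
  by rewrite mulf_neq0.
rewrite gE (upper (i0 - 2)) ?(lower (i0 - 1)) ?(above i0) ?mulr0 ?addr0 //; lia.
Qed.

(** If hi + d were positive, p - 1 would have the monomial of p in (hi, d)
    as its top part; if it were negative, the constant -1. *)
Lemma top_weight_zero (p q : int -> int -> int) (a b c N hi d : int) :
    a != 0 -> b != 0 ->
    (forall i e, q i e != 0 -> i <= N /\ e <= N) ->
    (forall i e, p i e - ((i == 0) && (e == 0))%:R =
       a * q (i - 2) e + b * q (i - 1) (e - 1) + c * q i e) ->
    (forall i e, p i e != 0 -> i <= hi /\ e <= d) -> p hi d != 0 ->
  hi + d = 0.
Proof.
move=> a0 b0 bound pE supp phd.
pose g i e := p i e - ((i == 0) && (e == 0))%:R.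
have g_supp i e : g i e != 0 -> i <= hi /\ e <= d \/ i = 0 /\ e = 0.
  rewrite /g; case: (i =P 0) => [->|_]; case: (e =P 0) => [->|_] /=;
    rewrite ?subr0; auto.
have [lt0|lt0|//] := ltgtP (hi + d) 0.
  have := top_weight_vanishes (D := 0) (i0 := 0) (e0 := 0) a0 b0 bound pE.
  rewrite !eqxx /= (_ : p 0 0 = 0) => [top|]; last first.
    by apply/eqP/negPn/negP => /supp; lia.
  suff: (0 - 1 : int) = 0 by [].
  by apply: top => // i e /g_supp; lia.
have := top_weight_vanishes (D := hi + d) (i0 := hi) (e0 := d) a0 b0 bound pE.
have -> : (hi == 0) && (d == 0) = false by lia.
rewrite subr0 => top; case/eqP: phd; apply: top => // i e /g_supp; lia.
Qed.

Lemma laurent2_bound (p : laurent2) : exists N : int,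
  forall i e, (zcoef p e)@_i != 0 -> `|i| <= N /\ `|e| <= N.
Proof.
pose row i : laurent int := p@_i.
pose N := \sum_(i <- msupp p) support_bound (row i).
have N_ge0 : 0 <= N by apply: sumr_ge0 => i _; apply: support_bound_ge0.
exists (support_bound p + N) => i e; rewrite zcoefE => pie.
have pi0 : p@_i != 0.
  apply: contra_neq pie => pi0.
  exact: etrans (congr1 (mcoeff e) pi0) (mcoeff0 _).
have le_e : support_bound (row i) <= N.
  rewrite mcoeff_neq0 in pi0; rewrite /N (big_fsetD1 i pi0) /= lerDl.
  by apply: sumr_ge0 => j _; apply: support_bound_ge0.
have := support_boundP pi0; have := support_boundP pie.
have := support_bound_ge0 p; rewrite -/(row i); lia.
Qed.

Lemma specializes_expand (R : comNzRingType) (a b c q : R) :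
  (a + b * c - 1) * q = a * q + b * (c * q) - q.
Proof. by ring. Qed.

Lemma coef_zcoef1 i e : (zcoef 1 e)@_i = ((i == 0) && (e == 0))%:R.
Proof.
rewrite zcoef1; case: (e == 0); rewrite ?andbT ?andbF ?mcoeff0 //.
by rewrite [LHS]mcoeffU eq_sym.
Qed.

Lemma specializes_coef p q i e :
    p - 1 = (vpow 2 + vpow 1 * zpow 1 - 1) * q ->
  (zcoef p e)@_i - ((i == 0) && (e == 0))%:R =
    (zcoef q e)@_(i - 2) + (zcoef q (e - 1))@_(i - 1) - (zcoef q e)@_i.
Proof.
move=> pq; pose s : laurent2 := vpow 1 * (zpow 1 * q).
have zs : (zcoef s e)@_i = (zcoef q (e - 1))@_(i - 1).
  rewrite [zcoef s e](etrans (zcoef_vpow _ _ _) (congr1 _ (zcoef_zpow _ _ _))).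
  exact: coef_tpow.
have zt : (zcoef (vpow 2 * q) e)@_i = (zcoef q e)@_(i - 2).
  by rewrite zcoef_vpow; exact: coef_tpow.
have {}pq : p - 1 = vpow 2 * q + s - q by rewrite pq; exact: specializes_expand.
have := congr1 (zcoef^~ e) pq; move: (vpow 2 * q) s zs zt {pq} => t s <- <- /=.
rewrite (zcoefB p) (zcoefB _ q) zcoefD => /(congr1 (mcoeff i)).
by rewrite !mcoeffB mcoeffD coef_zcoef1.
Qed.

(** * Rigidity *)

Definition scalar (c : int) : laurent2 := << << c *g 0 >> *g 0 >>.

Lemma zcoef_scalar c p e i : (zcoef (scalar c * p) e)@_i = c * (zcoef p e)@_i.
Proof.
rewrite !zcoefE [X in X@__]coefMU subr0.
by rewrite [LHS]coefMU subr0.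
Qed.

Definition tconst (c : int) : laurent int := << c *g 0 >>.

Lemma coef_tconst c f i : (tconst c * f)@_i = c * f@_i.
Proof. by rewrite [LHS]coefMU subr0. Qed.

Lemma zcoef_deltaX k e : zcoef (delta ^+ k) e =
  ((1 - tpow 2) ^+ k * tpow (- k%:Z)) *+ (e == - k%:Z).
Proof.
elim: k e => [|k IHk] e.
  by rewrite !expr0 zcoef1 mul1r.
rewrite exprS zcoef_delta IHk.
rewrite (_ : (e + 1 == - k%:Z) = (e == - k.+1%:Z)); last by lia.
case: eqP => _; last by rewrite !mulr0n !mulr0.
rewrite !mulr1n (_ : - k.+1%:Z = -1 - k%:Z); last by lia.
rewrite (tpowD (-1) (- k%:Z)) exprS; exact: mul_rearrange.
Qed.

Lemma specializes_deltaX k : specializes_to1 (delta ^+ k).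
Proof.
elim: k => [|k IHk]; first by exists 0; rewrite subrr mulr0.
rewrite exprS; exact: specializes_delta.
Qed.

Lemma ideal_const (R : comNzRingType) (f c x a b : R) :
  c * x - 1 = f * a -> x - 1 = f * b -> c - 1 = f * (a - c * b).
Proof.
move=> cx xb; transitivity (c * x - 1 - c * (x - 1)); first by ring.
by rewrite cx xb; ring.
Qed.

(** If the extreme v-degrees of p both occur with the top z-degree d, the top
    weights of p for i + e and for -i + e are attained by single monomials, and
    the congruence p = 1 places both at weight 0.  Then p has too small a v-span
    for its coefficients to be divisible as they must be, except for delta^k. *)
Theorem homflypt_rigidity (p : laurent2) (lo hi d : int) :
    specializes_to1 p -> tdivisible p ->
    (forall i e, (zcoef p e)@_i != 0 -> lo <= i <= hi /\ e <= d) ->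
    (zcoef p d)@_lo != 0 -> (zcoef p d)@_hi != 0 ->
  exists2 k : nat, hi - lo = k.*2%:Z & p = delta ^+ k.
Proof.
move=> [q pq] divp supp p_lo p_hi.
have [N bound] := laurent2_bound q.
pose qc i e := (zcoef q e)@_i.
have coef_pq i e := specializes_coef i e pq.
have hi_d : hi = - d.
  suff : hi + d = 0 by lia.
  apply: (@top_weight_zero (fun i e => (zcoef p e)@_i) qc 1 1 (-1) N) => //.
  - by move=> i e /bound; lia.
  - by move=> i e; rewrite coef_pq !mul1r mulN1r.
  by move=> i e /supp; lia.
(* The same argument after the substitution of 1/v for v; the shift of the
   exponents of q makes up for v^2 + v z - 1 becoming 1/v^2 + z/v - 1. *)
have lo_d : lo = d.
  suff : - lo + d = 0 by lia.
  apply: (@top_weight_zero (fun i e => (zcoef p e)@_(- i))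
            (fun i e => qc (- i - 2) e) (-1) 1 1 (N + 2)) => //.
  - by move=> i e /bound; lia.
  - move=> i e; have := coef_pq (- i) e; rewrite oppr_eq0 => ->; rewrite /qc.
    rewrite (_ : - (i - 2) - 2 = - i); last by lia.
    rewrite (_ : - (i - 1) - 2 = - i - 1); last by lia.
    have rot (x y z : int) : x + y - z = - z + y + x by lia.
    by rewrite mulN1r !mul1r; exact: rot.
  - by move=> i e /supp; lia.
  by rewrite opprK.
have [k def_d] : exists k : nat, d = - k%:Z.
  by exists `|d|%N; have [] := supp _ _ p_lo; lia.
exists k; first by lia.
have [r0 def_r0] := divp k.
have r0_supp : forall i, r0@_i != 0 -> i = - k%:Z.
  move=> i ri; have := @support_factorX r0 (- k%:Z) k%:Z k _ i ri.
  suff H j : ((1 - tpow 2) ^+ k * r0)@_j != 0 -> - k%:Z <= j <= k%:Z.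
    by move=> /(_ H); lia.
  by rewrite -def_r0 => /supp; lia.
pose c := r0@_(- k%:Z).
have r0E : r0 = tconst c * tpow (- k%:Z).
  apply: laurentP => i; rewrite coef_tconst mcoeffU.
  have [<-|neq_i] := eqVneq (- k%:Z) i; first by rewrite mulr1n mulr1.
  by rewrite mulr0n mulr0; apply/eqP/negPn/negP => /r0_supp; lia.
clearbody c.
have zcoef_lt e : e < d -> zcoef p e = 0.
  move=> lt_e; have [k' def_e] : exists k' : nat, e = - k'%:Z.
    by exists `|e|%N; lia.
  have [r def_r] := divp k'; rewrite def_e def_r.
  suff -> : r = 0 by rewrite mulr0.
  apply: laurentP => i; rewrite mcoeff0; apply/eqP/negPn/negP => ri.
  have := @support_factorX r (- k%:Z) k%:Z k' _ i ri.
  suff H j : ((1 - tpow 2) ^+ k' * r)@_j != 0 -> - k%:Z <= j <= k%:Z.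
    by move=> /(_ H); lia.
  by rewrite -def_r => /supp; lia.
have zcoef_gt e : d < e -> zcoef p e = 0.
  move=> lt_e; apply: laurentP => i; rewrite mcoeff0.
  by apply/eqP/negPn/negP => /supp; lia.
have def_p : p = scalar c * delta ^+ k.
  apply: zcoefP => e; apply: laurentP => i; rewrite zcoef_scalar zcoef_deltaX.
  have [->|neq_e] := eqVneq e (- k%:Z).
    rewrite def_r0 mulr1n -coef_tconst; congr mcoeff.
    rewrite r0E; exact: (@mulrCA (laurent int) _ (tconst c)).
  rewrite mulr0n mcoeff0 mulr0.
  have [lt_e|lt_e|eq_e] := ltgtP e d; [|by rewrite zcoef_gt ?mcoeff0|lia].
  by rewrite zcoef_lt ?mcoeff0.
have [q' q'E] := specializes_deltaX k.
have const_eq :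
    scalar c - 1 = (vpow 2 + vpow 1 * zpow 1 - 1) * (q - scalar c * q').
  by rewrite def_p in pq; apply: ideal_const pq q'E.
move: (q - scalar c * q') const_eq => s const_eq.
have [N' bound'] := laurent2_bound s.
(* A constant in the ideal is zero: its top part is a monomial. *)
have c1 : c - 1 = 0.
  pose g i e := (zcoef (scalar c) e)@_i - ((i == 0) && (e == 0))%:R.
  have gE i e : g i e = (c - 1) * ((i == 0) && (e == 0))%:R.
    by rewrite /g mulrBl mul1r -coef_zcoef1 -zcoef_scalar mulr1.
  suff : g 0 0 = 0 by rewrite gE mulr1.
  apply: (@top_weight_vanishes g (fun i e => (zcoef s e)@_i)
            1 1 (-1) N' 0) => //.
  - by move=> i e /bound'; lia.
  - by move=> i e; rewrite /g (specializes_coef i e const_eq) !mul1r mulN1r.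
  move=> i e; rewrite gE; case: (i =P 0) => [->|_]; last by rewrite mulr0.
  by case: (e =P 0) => [->|_]; rewrite ?mulr0.
rewrite def_p (subr0_eq c1); exact: mul1r.
Qed.

Definition nat_word (n : nat) (beta : braid n) : seq (nat * bool) :=
  [seq (nat_of_ord x.1, x.2) | x <- (beta : seq ('I_n.-1 * bool))].

Lemma braid_closureE P n (beta : braid n) :
  P (braid_closure beta) = closure_poly P n (nat_word beta).
Proof. by rewrite /closure_poly /braid_tangle -map_comp. Qed.

Lemma writheE n (beta : braid n) :
  writhe beta = exponent_sum (nat_word beta).
Proof. by rewrite /exponent_sum big_map. Qed.

Theorem corollary2p7 (P : diagram -> laurent2) (hP : homflypt P)
    (n : nat) (beta : braid n) (m M : 'I_n) (d : int)
    (hm : first_proper (mfw P beta) m)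
    (hM : last_proper (mfw P beta) M)
    (dm : is_deg (mfw P beta m) d)
    (dM : is_deg (mfw P beta M) d)
    (dP : is_zdeg (P (braid_closure beta)) d) :
  P (braid_closure beta) = P (trivial_link (bmin m M)) /\
  P (trivial_link (bmin m M)) =
    ((1 - vpow 2) * (vpow (-1) * zpow (-1))) ^+ (bmin m M - 1).
Proof.
have bminS : bmin m M = (M - m).+1.
  have le_mM : (m <= M)%N by have [_] := hm; apply; case: hM.
  rewrite /bmin; lia.
rewrite bminS subn1 /= (trivial_linkE hP); split=> //.
case: n beta m M hm hM dm dM dP bminS => [|n] beta m M; first by case: m.
move=> [_ m_min] [_ M_max] [dm _] [dM _] [_ d_max] _.
set w := nat_word beta.
have wfw : braid_word n.+1 w.
  by apply/allP => _ /mapP[x _ ->] /=; rewrite ltnS.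
have def_p : P (braid_closure beta) = closure_poly P n.+1 w.
  exact: braid_closureE.
have hE j : mfw P beta j =
    (closure_poly P n.+1 w)@_(exponent_sum w - n.+1%:Z + 1 + j.*2%:Z).
  by rewrite /mfw def_p writheE.
have bound := closed_braid_mfw hP wfw.
move: (closed_braid_specializes hP wfw) (closed_braid_tdivisible hP wfw).
move: hE bound d_max; rewrite {}def_p.
move: (closure_poly P n.+1 w) (exponent_sum w) => p e0.
move=> hE bound d_max spec div.
have supp i e : (zcoef p e)@_i != 0 ->
    e0 - n.+1%:Z + 1 + m.*2%:Z <= i <= e0 - n.+1%:Z + 1 + M.*2%:Z /\ e <= d.
  rewrite zcoefE => pie; split; last exact: d_max pie.
  have pi0 : p@_i != 0.
    apply: contra_neq pie => pi0.
    exact: etrans (congr1 (mcoeff e) pi0) (mcoeff0 _).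
  have [j lt_j def_i] := bound i pi0.
  have hj : mfw P beta (Ordinal lt_j) != 0 by rewrite hE /= -def_i.
  by have /= := m_min _ hj; have /= := M_max _ hj; lia.
have [||k def_k ->] := homflypt_rigidity spec div supp.
- by rewrite zcoefE -hE.
- by rewrite zcoefE -hE.
congr (_ ^+ _); lia.
Qed.
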